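(* Let $G$ be a connected graph of order $n\ge 3$. Then $$\operatorname{th}_{\gamma_P}^{\times}(G)\le \frac{6n}{7},$$ and this bound is sharp (that is, there exist connected graphs $G$ of order $n\ge 3$ with $\operatorname{th}_{\gamma_P}^{\times}(G)=\frac{6n}{7}$).
   Context: All graphs are finite, simple and undirected; the order of $G$ is $n=|V(G)|$. Power domination propagation process: start with a set $B\subseteq V(G)$ of filled vertices, all other vertices being unfilled. In time step 1 (the domination step), every neighbor of a vertex of $B$ is filled. In each later time step, every vertex $w$ for which there is a filled vertex $v$ (filled at the end of the previous time step) such that $w$ is the unique unfilled neighbor of $v$ becomes filled (all such fillings are performed simultaneously). Let $B^{[0]}=B$ and let $B^{[i]}$ be the set of vertices filled after time step $i$. The propagation time $\operatorname{pt}_{\gamma_P}(G,B)$ is the least $t\ge 0$ with $B^{[t]}=V(G)$, and $\operatorname{pt}_{\gamma_P}(G,B)=\infty$ if no such $t$ exists. The initial cost product throttling number for power domination is $$\operatorname{th}_{\gamma_P}^{\times}(G)=\min_{1\le k\le n}\ \min_{B\subseteq V(G),\,|B|=k}|B|\,\bigl(1+\operatorname{pt}_{\gamma_P}(G,B)\bigr).$$ *)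

(* Defs.v *)
From HB Require Import structures.
From mathcomp Require Import all_boot all_order all_algebra.
From mathcomp Require Import boolp constructive_ereal.

Set Implicit Arguments.
Unset Strict Implicit.
Unset Printing Implicit Defensive.

Import Order.TTheory GRing.Theory Num.Theory.

Record sgraph := SGraph {
  vertex :> finType;
  adj : rel vertex;
  adj_sym : symmetric adj;
  adj_irrefl : irreflexive adj
}.

Definition connected_graph (G : sgraph) : Prop :=
  forall x y : G, connect (@adj G) x y.

Section PowerDomination.

Variable G : sgraph.
Implicit Types (v w : G) (B S : {set G}).

Definition nbrs v : {set G} := [set w | adj v w].

Definition dom_step B : {set G} := B :|: \bigcup_(v in B) nbrs v.

Definition force_step S : {set G} :=
  S :|: [set w | [exists v in S, nbrs v :\: S == [set w]]].

Definition filled B (i : nat) : {set G} :=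
  if i is j.+1 then iter j force_step (dom_step B) else B.

Local Open Scope ring_scope.
Local Open Scope ereal_scope.

Definition pt B : \bar rat :=
  match pselect (exists t, filled B t == setT) with
  | left ex_t => (ex_minn ex_t)%:R%:E
  | right _ => +oo
  end.

(* Only nonempty [B] occur below, so the product [0 * +oo] (which is [0] in
   the library) never does. The index [+oo] is neutral for the minimum. *)
Definition th : \bar rat :=
  \big[Order.min/+oo]_(1 <= k < #|G|.+1)
    \big[Order.min/+oo]_(B : {set G} | #|B| == k) (#|B|%:R%:E * (1 + pt B)).

End PowerDomination.

(* Main.v *)
Require Import Defs.
From mathcomp Require Import all_boot all_order all_algebra.
From mathcomp Require Import boolp constructive_ereal zify.

Set Implicit Arguments.
Unset Strict Implicit.
Unset Printing Implicit Defensive.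

(* Some dominating set [D] and some set [X] filling the graph in two steps
   satisfy [#|D| + 2 * #|X| <= n]. Hence [7 * #|D| <= 3 * n], and [D] costs
   [2 * #|D| <= 6n/7], or [7 * #|X| < 2 * n], and [X] costs [3 * #|X| < 6n/7].
   To find them, choose a minimum dominating set [D] without leaves in which
   every vertex [d] has an external private neighbor [f d]. Then the subgraph
   induced on the complement [W] of [f @: D] has no isolated vertex, so by Ore's
   theorem at most half of [W] dominates [W]; after that, each [d] has [f d] as
   its only possibly unfilled neighbor and forces it.
   The bound is attained by the tree on 7 vertices obtained from the path
   1-0-3-5-6 by attaching the leaf 2 to 0 and the leaf 4 to 3. *)

(** * Domination, connectivity and Ore's theorem *)

Lemma dom_stepP (G : sgraph) (B : {set G}) (x : G) :
  reflect (x \in B \/ exists2 b, b \in B & adj b x) (x \in dom_step B).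
Proof.
rewrite in_setU; apply: (iffP orP) => -[xB|xN]; [by left|right|by left|right].
  by case/bigcupP: xN => b bB; rewrite inE => bx; exists b.
by case: xN => b bB bx; apply/bigcupP; exists b; rewrite ?inE.
Qed.

(** Without such an edge [S] would be closed under adjacency, hence a union of components. *)
Lemma exists_boundary_edge (G : sgraph) (S : {set G}) (x0 y0 : G) :
  connected_graph G -> x0 \in S -> y0 \notin S ->
  exists x y : G, [/\ x \in S, y \notin S & adj x y].
Proof.
move=> Gc x0S y0S; apply: contrapT => noxy.
have Scl : closed (@adj G) S.
  apply: (intro_closed (sym_connect_sym (@adj_sym G))) => x y xy xS.
  by apply: contrapT => /negP yS; apply: noxy; exists x, y.
by move: y0S; rewrite -(closed_connect Scl (Gc x0 y0)) x0S.
Qed.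

(* Ore: the complement in [W] of a minimal set dominating [W] dominates [W]
   as well, so the smaller of the two has at most half of the elements. *)
Lemma dominating_half (G : sgraph) (W : {set G}) :
  (forall w, w \in W -> exists2 v, v \in W & adj w v) ->
  exists X : {set G}, [/\ X \subset W, W \subset dom_step X & 2 * #|X| <= #|W|].
Proof.
move=> Wnbr.
pose P := [pred X : {set G} | (X \subset W) && (W \subset dom_step X)].
have PW : P W by rewrite inE subxx subsetUl.
have [X /minsetP[/andP[XW domX] minX] _] := minset_exists PW.
(* A vertex [x] of [W] missed by [W :\: X] lies in [X] together with all its neighbors in [W]. Then
   [X :\ x] still dominates [W], against minimality. *)
have domC : W \subset dom_step (W :\: X).
  apply/subsetP => x xW; apply/dom_stepP; apply: contrapT => xC.
  have xX : x \in X.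
    by apply: contrapT => /negP xX; apply: xC; left; rewrite inE xX.
  have nbrX v : v \in W -> adj x v -> v \in X.
    move=> vW xv; apply: contrapT => /negP vX; apply: xC; right.
    by exists v; rewrite 1?adj_sym // inE vX.
  suff PX : P (X :\ x).
    by move/(minX _ PX): (subD1set X x) => /setP/(_ x); rewrite !inE eqxx xX.
  rewrite inE (subset_trans (subD1set _ _) XW) /=.
  apply/subsetP => v vW; apply/dom_stepP.
  have [->|vx] := eqVneq v x.
    have [u uW xu] := Wnbr x xW; right; exists u; last by rewrite adj_sym.
    rewrite !inE (nbrX u) // andbT.
    by apply: contraTneq xu => ->; rewrite adj_irrefl.
  case/dom_stepP: (subsetP domX v vW) => [vX|[b bX bv]].
    by left; rewrite !inE vx.
  have [bx|bx] := eqVneq b x; last by right; exists b; rewrite // !inE bx.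
  by left; rewrite !inE vx nbrX // -bx.
have cardW : #|W :\: X| + #|X| = #|W|.
  by have /setIidPr {2}<- := XW; rewrite addnC cardsID.
 have [leX|ltX] := leqP (2 * #|X|) #|W|; first by exists X.
by exists (W :\: X); split; rewrite ?subsetDl //; lia.
Qed.

(** * Minimum dominating sets, leaves and external private neighbors *)

Definition nonleaf (G : sgraph) : {set G} := [set x | 1 < #|nbrs x|].

Definition inner_arcs (G : sgraph) (D : {set G}) : {set G * G} :=
  [set e | [&& e.1 \in D, e.2 \in D & adj e.1 e.2]].

(** Potential for an exchange argument: the first term, twice the number of edges inside [D], serves
    to produce private neighbors; the second serves to exclude leaves. *)
Definition dom_score (G : sgraph) (D : {set G}) : nat :=
  #|inner_arcs D| + #|D :&: nonleaf G|.

Lemma nonleafP (G : sgraph) (x y z : G) :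
  adj x y -> adj x z -> y != z -> x \in nonleaf G.
Proof.
move=> xy xz yz; rewrite inE; apply/card_gt1P.
by exists y, z; rewrite !inE.
Qed.

(** As [d] is isolated in [D], the swap loses no inner arc, and it gains the nonleaf [y]. If the
    score does not grow, a nonleaf [d] must have been lost in exchange, and no new arc at [y] can
    have appeared. *)
Lemma dom_score_swap (G : sgraph) (D : {set G}) (d y : G) :
  d \in D -> (forall c, c \in D -> ~~ adj c d) -> y \notin D ->
  y \in nonleaf G -> dom_score (y |: D :\ d) <= dom_score D ->
  d \in nonleaf G /\ (forall c, c \in D -> adj c y -> c = d).
Proof.
move=> dD disol yD yNL le_score; set D' := y |: D :\ d in le_score.
have subA : inner_arcs D \subset inner_arcs D'.
  apply/subsetP => -[a b]; rewrite !inE /= => /and3P[aD bD ab].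
  rewrite aD bD ab !andbT; apply/andP; split; apply/orP; right.
    by apply: contraTneq ab => ->; rewrite adj_sym disol.
  by apply: contraTneq ab => ->; rewrite disol.
have := cardsD1 d (D :&: nonleaf G); rewrite [d \in D :&: _]inE dD /= => cardNL.
have cardNL' : #|D' :&: nonleaf G| = (#|(D :&: nonleaf G) :\ d|).+1.
  have -> : D' :&: nonleaf G = y |: (D :&: nonleaf G) :\ d.
    apply/setP => x; rewrite !in_setI !in_setU1 !in_setD1 !in_setI.
    by have [->|_] := eqVneq x y; rewrite ?yNL //= andbA.
  by rewrite cardsU1 !inE (negbTE yD) andbF.
have := subset_leq_card subA; rewrite /dom_score in le_score.
move=> leA; split; first by case: (d \in _) cardNL => //=; lia.
move=> c cD cy; apply: contrapT => /eqP cd.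
have ltA : #|inner_arcs D| < #|inner_arcs D'|.
  apply: proper_card; rewrite properE subA; apply/subsetPn.
  exists (c, y); rewrite !inE /=; first by rewrite cd cD cy eqxx orbT.
  by rewrite (negbTE yD) andbF.
by case: (d \in nonleaf G) cardNL => /=; lia.
Qed.

(* Among the minimum dominating sets, one maximizing [dom_score] works: a
   vertex violating the conclusion could be swapped for one of its neighbors. *)
Lemma exists_private_dominating (G : sgraph) :
  connected_graph G -> 3 <= #|G| ->
  exists D : {set G}, dom_step D = setT /\
    forall d, d \in D -> d \in nonleaf G /\
      exists2 p, p \notin D & nbrs p :&: D = [set d].
Proof.
move=> Gc G3.
pose P := [pred D : {set G} | dom_step D == setT].
have PT : P setT by rewrite /= -subTset subsetUl.
case: (arg_minnP (fun D : {set G} => #|D|) PT) => D0 PD0 minD0.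
pose Q := [pred D : {set G} | P D && (#|D| == #|D0|)].
have QD0 : Q D0 by rewrite /= eqxx andbT; exact: PD0.
case: (arg_maxnP (@dom_score G) QD0) => D /andP[/eqP domD /eqP cardD] maxD.
have dom x : x \in D \/ exists2 b, b \in D & adj b x.
  by apply/dom_stepP; rewrite domD.
have minD (S : {set G}) : dom_step S = setT -> #|D| <= #|S|.
  by move/eqP=> domS; rewrite cardD; exact: (minD0 S domS).
(* The swapped set is as large as [D] and still dominates: [y] reaches [d], and each other outside
   neighbor of [d] is reached by some [c]. So the maximality of the score applies to it. *)
have maxswap d y : d \in D -> y \notin D -> adj d y ->
    (forall x, x \notin D -> adj d x ->
       x = y \/ exists c, [/\ c \in D, c != d & adj c x]) ->
    (forall c, c \in D -> ~~ adj c d) -> y \in nonleaf G ->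
    d \in nonleaf G /\ (forall c, c \in D -> adj c y -> c = d).
  move=> dD yD dy xP disol yNL; apply: dom_score_swap => //.
  apply: maxD; rewrite /= cardsU1 !inE (negbTE yD) andbF /= -cardD.
  rewrite [#|D|](cardsD1 d) dD eqxx andbT -subTset.
  apply/subsetP => x _; apply/dom_stepP.
  have [xD|xD] := boolP (x \in D).
    have [->|xd] := eqVneq x d; last by left; rewrite !inE xd xD orbT.
    by right; exists y; rewrite ?setU11 // adj_sym.
  case: (dom x) xD => [->//|[b bD bx] xD].
  have [bd|bd] := eqVneq b d.
    rewrite bd in bx; case: (xP x xD bx) => [->|[c [cD cd cx]]].
      by left; rewrite setU11.
    by right; exists c; rewrite // !inE cD cd orbT.
  by right; exists b; rewrite // !inE bD bd orbT.
have nbrG (x : G) : exists y : G, adj x y.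
  have /existsP[z xz] : [exists z : G, z != x].
    apply: contraTT G3 => /existsPn allx; rewrite -leqNgt -ltnS.
    apply: leq_trans (_ : #|[set x]| < 3); last by rewrite cards1.
    rewrite ltnS; apply/subset_leq_card/subsetP => z _.
    by rewrite inE; apply: contraNT (allx z).
  have zx : z \notin [set x] by rewrite inE.
  have [a [b [/set1P-> _ ab]]] := exists_boundary_edge Gc (set11 x) zx.
  by exists b.
(* Without a private neighbor, [d] is isolated in [D], since otherwise [D :\ d] would dominate. Any
   neighbor [y] of [d] then has a second neighbor [c] in [D], and swapping [d] for [y] would create
   a new inner arc. *)
have epn d : d \in D -> exists2 p, p \notin D & nbrs p :&: D = [set d].
  move=> dD; apply: contrapT => nop.
  have other x : x \notin D -> adj d x ->
      exists c, [/\ c \in D, c != d & adj c x].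
    move=> xD dx; apply: contrapT => noc; apply: nop; exists x => //.
    apply/setP => c; rewrite !inE; apply/andP/eqP => [[xc cD]|->]; last first.
      by rewrite adj_sym.
    by apply: contrapT => /eqP cd; apply: noc; exists c; rewrite adj_sym.
  have disol c : c \in D -> ~~ adj c d.
    move=> cD; apply/negP => cd.
    have : dom_step (D :\ d) = setT.
      apply/eqP; rewrite -subTset; apply/subsetP => x _; apply/dom_stepP.
      have cDd : c \in D :\ d.
        rewrite !inE cD andbT; apply: contraTneq cd => ->.
        by rewrite adj_irrefl.
      have [->|xd] := eqVneq x d; first by right; exists c.
      have [xD|xD] := boolP (x \in D); first by left; rewrite !inE xd.
      case: (dom x) xD => [->//|[b bD bx] xD].
      have [bd|bd] := eqVneq b d; last by right; exists b; rewrite // !inE bd.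
      rewrite bd in bx; have [e [eD ed ex]] := other x xD bx.
      by right; exists e; rewrite // !inE ed.
    by move/minD; rewrite [#|D|](cardsD1 d) dD ltnn.
  have [y dy] := nbrG d.
  have yD : y \notin D by apply: contraTN dy => /disol; rewrite adj_sym.
  have [c [cD cd cy]] := other y yD dy.
  have yNL : y \in nonleaf G.
    by apply: (@nonleafP _ _ c d); rewrite // adj_sym.
  have [|_ /(_ c cD cy) /eqP] := maxswap d y dD yD dy _ disol yNL.
    by move=> x xD dx; right; apply: other.
  by rewrite (negbTE cd).
exists D; split=> // d dD; split; last exact: epn.
(* A leaf [d] has its private neighbor [p] as only neighbor. Some edge leaves the pair [d], [p],
   necessarily at [p], so [p] is a nonleaf and swapping [d] for [p] would raise the score. *)
apply: contrapT => /negP dL.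
have [p pD pd] := epn d dD.
have dp : adj d p by move/setP/(_ d): pd; rewrite !inE eqxx dD andbT adj_sym.
have only x : adj d x -> x = p.
  by move=> dx; apply: contrapT => /eqP xp; rewrite (nonleafP dx dp xp) in dL.
have pNL : p \in nonleaf G.
  have /subsetPn[z _ zS] : ~~ ([set: G] \subset [set d; p]).
    apply: contraTN G3 => /subset_leq_card; rewrite cardsT cards2.
    by case: eqVneq => /=; lia.
  have [a [b [aS bS ab]]] := exists_boundary_edge Gc (set21 d p) zS.
  case/set2P: aS ab => -> ab; first by rewrite (only b ab) set22 in bS.
  apply: (@nonleafP _ _ b d); rewrite // 1?adj_sym //.
  by apply: contraNneq bS => ->; rewrite set21.
have disol c : c \in D -> ~~ adj c d.
  move=> cD; apply: contraNN pD; rewrite adj_sym => /only <-//.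
have [|dNL _] := maxswap d p dD pD dp _ disol pNL; last by rewrite dNL in dL.
by move=> x _ /only; left.
Qed.

(** * Trade-off between filling in one step and in two steps *)

Lemma domination_trade_off (G : sgraph) :
  connected_graph G -> 3 <= #|G| ->
  exists D X : {set G}, [/\ filled D 1 = setT, filled X 2 = setT &
    #|D| + 2 * #|X| <= #|G|].
Proof.
move=> Gc G3; have [D [domD privD]] := exists_private_dominating Gc G3.
(* The default value never occurs for [d] in [D], where the pick succeeds. *)
pose f d := odflt d [pick p | (p \notin D) && (nbrs p :&: D == [set d])].
have fP d : d \in D -> f d \notin D /\ nbrs (f d) :&: D = [set d].
  case/privD => _ [p pD pd]; rewrite /f; case: pickP => [q|/(_ p)] /=.
    by case/andP=> qD /eqP.
  by rewrite pD pd eqxx.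
have fadj d d' : d \in D -> d' \in D -> adj (f d) d' = (d' == d).
  move=> dD d'D; have [_ /setP/(_ d')] := fP d dD.
  by rewrite !inE d'D andbT.
pose W := ~: (f @: D).
have inW d : d \in D -> d \in W.
  move=> dD; rewrite inE; apply/imsetP => -[c cD dc].
  by have [] := fP c cD; rewrite -dc dD.
have [|X [XW domX leX]] := @dominating_half G W.
  (* Outside [D], a dominator of [w] serves, as [D] lies in [W]. In [D], [w] has two neighbors, and
     only [f w] among its neighbors can lie outside [W]. *)
  move=> w wW; have [wD|wD] := boolP (w \in D); last first.
    have : w \in dom_step D by rewrite domD.
    case/dom_stepP; first by rewrite (negbTE wD).
    by case=> b bD bw; exists b; rewrite ?inW // adj_sym.
  have [+ _] := privD w wD; rewrite inE => /card_gt1P[u [v []]].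
  rewrite !inE => wu wv uv.
  have [uW|] := boolP (u \in W); first by exists u.
  rewrite inE negbK => /imsetP[e eD ue].
  have [vW|] := boolP (v \in W); first by exists v.
  rewrite inE negbK => /imsetP[c cD vc].
  move: wu wv uv; rewrite adj_sym ue fadj // => /eqP->.
  by rewrite adj_sym vc fadj // => /eqP->; rewrite eqxx.
exists D, X; split=> //.
  (* A vertex unfilled after the first step is some [f d]; [d] itself is filled, and its other
     neighbors lie in [W], so [d] forces it. *)
  apply/eqP; rewrite -subTset; apply/subsetP => x _ /=; rewrite in_setU.
  have [//|xS] := boolP (x \in dom_step X).
  have : x \notin W by apply: contraNN xS; apply: (subsetP domX).
  rewrite !inE negbK => /imsetP[d dD xd]; apply/existsP; exists d.
  rewrite (subsetP domX) ?inW //=; apply/eqP/setP => y.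
  rewrite in_setD in_set1 [y \in nbrs d]inE.
  apply/andP/eqP => [[yS dy]|->]; last by rewrite xS xd adj_sym fadj.
  have : y \notin W by apply: contraNN yS; apply: (subsetP domX).
  rewrite !inE negbK => /imsetP[e eD ye].
  by move: dy; rewrite ye adj_sym fadj // xd => /eqP->.
(* Injectivity of [f] on [D] makes [W] have exactly [#|G| - #|D|] elements. *)
have : #|f @: D| = #|D|.
  apply: card_in_imset => a b aD bD fab.
  by apply/eqP; rewrite -(fadj b a) // -fab fadj.
by have := cardsC (f @: D); rewrite -/W; lia.
Qed.

(** * Bounds on the throttling number, and forts *)

Import Order.TTheory GRing.Theory Num.Theory.

Lemma pt_le (G : sgraph) (B : {set G}) (t : nat) :
  filled B t = setT -> (pt B <= t%:R%:E)%E.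
Proof.
move=> Bt; rewrite /pt; case: pselect => [ex|[]]; last by exists t; apply/eqP.
by rewrite lee_fin ler_nat; case: ex_minnP => m _; apply; apply/eqP.
Qed.

Lemma th_le (G : sgraph) (B : {set G}) (t : nat) :
  0 < #|B| -> filled B t = setT -> (th G <= (#|B| * t.+1)%:R%:E)%E.
Proof.
move=> B0 Bt; rewrite /th; apply: (bigmin_inf_seq _ #|B|) => //.
  by rewrite mem_index_iota B0 ltnS max_card.
apply: (bigmin_inf B) => //.
rewrite natrM EFinM lee_pmul2l ?lte_fin ?ltr0n //.
by rewrite -add1n natrD EFinD leeD2l // pt_le.
Qed.

Lemma le_th (G : sgraph) (m : nat) :
  (forall (B : {set G}) t, 0 < #|B| -> filled B t = setT -> m <= #|B| * t.+1) ->
  (m%:R%:E <= th G)%E.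
Proof.
move=> le_m; rewrite /th big_seq_cond; apply: le_bigmin; first exact: leey.
move=> k; rewrite mem_index_iota andbT => /andP[k0 _].
apply: le_bigmin => [|B /eqP Bk]; first exact: leey.
rewrite -Bk in k0 *; rewrite /pt; case: pselect => [ex|_]; last first.
  (* A set that never fills the graph costs [+oo], because its size is positive. *)
  by rewrite addey // gt0_muley ?leey // lte_fin ltr0n.
case: ex_minnP => t /eqP Bt _.
by rewrite -EFinD -EFinM lee_fin nat1r -natrM ler_nat le_m.
Qed.

(* A set [F] such that no outside vertex has exactly one neighbor in [F] can
   only be entered in the domination step. *)
Lemma fort_meets_dom_step (G : sgraph) (F B : {set G}) (w0 : G) (t : nat) :
  w0 \in F ->
  (forall v w, v \notin F -> w \in F -> adj v w ->
     exists u, [/\ u \in F, u != w & adj v u]) ->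
  filled B t = setT -> exists2 w, w \in F & w \in dom_step B.
Proof.
move=> w0F fortF Bt; apply: contrapT => noF.
(* A first forced vertex of [F] would be forced from outside [F], by a vertex with a second unfilled
   neighbor in [F]. *)
suff noFt : forall j w, w \in F -> w \notin iter j (@force_step G) (dom_step B).
  case: t Bt => [|j] Bt; last by move: (noFt j w0 w0F); rewrite [iter _ _ _]Bt inE.
  by move: (noFt 0 w0 w0F); rewrite /= [B]Bt !inE.
elim=> [|j IHj] w wF /=.
  by apply/negP => wB; apply: noF; exists w.
rewrite in_setU negb_or IHj // inE /=; apply/existsP => -[v].
set S := iter _ _ _ in IHj *; case/andP=> vS /eqP Nv.
have vw : adj v w by move/setP/(_ w): Nv; rewrite !inE eqxx => /andP[].
have vF : v \notin F by apply: contraTN vS => /IHj.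
have [u [uF uw vu]] := fortF v w vF wF vw.
by move/setP/(_ u): Nv; rewrite in_setD in_set1 inE vu IHj // (negbTE uw).
Qed.

(** * The extremal tree on 7 vertices *)

Definition tree7_edges : seq (nat * nat) :=
  [:: (0, 1); (0, 2); (0, 3); (3, 4); (3, 5); (5, 6)].

Definition tree7_adj : rel 'I_7 :=
  fun i j => ((i : nat, j : nat) \in tree7_edges) || ((j : nat, i : nat) \in tree7_edges).

Lemma tree7_sym : symmetric tree7_adj.
Proof. by move=> i j; rewrite /tree7_adj orbC. Qed.

Lemma tree7_irrefl : irreflexive tree7_adj.
Proof. by case=> -[|[|[|[|[|[|[|//]]]]]]] ?. Qed.

Definition tree7 : sgraph := SGraph tree7_sym tree7_irrefl.

Definition v7 (k : nat) : tree7 := inord k.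

Lemma tree7_connected : connected_graph tree7.
Proof.
have sym := sym_connect_sym (@adj_sym tree7).
have edge i j : (i, j) \in tree7_edges -> i < 7 -> j < 7 ->
    connect (@adj tree7) (v7 i) (v7 j).
  by move=> ij i7 j7; apply: connect1; rewrite /= /tree7_adj !inordK // ij.
have root k : k < 7 -> connect (@adj tree7) (v7 0) (v7 k).
  have root3 : connect (@adj tree7) (v7 0) (v7 3) by apply: edge.
  have root5 := connect_trans root3 (edge 3 5 isT isT isT).
  case: k => [|[|[|[|[|[|[|//]]]]]]] _ //; try exact: edge.
    by apply: (connect_trans root3); apply: edge.
  by apply: (connect_trans root5); apply: edge.
move=> x y; rewrite -(inord_val x) -(inord_val y).
apply: (connect_trans (y := v7 0)); first rewrite sym.
  by apply: root; apply: ltn_ord.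
by apply: root; apply: ltn_ord.
Qed.

Lemma tree7_cost (B : {set tree7}) (t : nat) :
  0 < #|B| -> filled B t = setT -> 6 <= #|B| * t.+1.
Proof.
have near (w : tree7) : w \in dom_step B ->
    exists2 b, b \in B & (b == w) || adj b w.
  by case/dom_stepP => [wB|[b bB bw]]; [exists w|exists b];
    rewrite ?eqxx ?bw ?orbT.
case: t => [|[|t]] B0 Bt.
- by rewrite [B]Bt cardsT card_ord.
(* One step: the closed neighborhoods of 1, 4 and 6 are pairwise disjoint and [B] meets each, so it
   has 3 elements. *)
- have mem k : k < 7 -> exists2 b : tree7, b \in B & (b == v7 k) || adj b (v7 k).
    by move=> _; apply: near; move/setP/(_ (v7 k)): Bt; rewrite in_setT.
  have [a aB a1] := mem 1 isT; have [b bB b4] := mem 4 isT.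
  have [c cB c6] := mem 6 isT.
  suff: 2 < #|B| by lia.
  apply/card_gt2P; exists a, b, c; split=> //.
  move: a1 b4 c6; rewrite /= /tree7_adj -!val_eqE /= !inordK //.
  case: a {aB} => -[|[|[|[|[|[|[|//]]]]]]] ? //= _;
    case: b {bB} => -[|[|[|[|[|[|[|//]]]]]]] ? //= _;
    by case: c {cB} => -[|[|[|[|[|[|[|//]]]]]]] ? //= _.
(* Two or more steps: 1, 2 form a fort, entered only through 0, and 4, 5, 6 another, entered only
   through 3. Their closed neighborhoods are disjoint, so [B] has 2 elements and costs at least 2
   times 3. *)
- have [||a aF aB] := fort_meets_dom_step
    (F := [set w : tree7 | (w : nat) \in [:: 1; 2]]) (w0 := v7 1) _ _ Bt.
  + by rewrite inE inordK.
  + move=> v w; rewrite !inE => vF wF vw.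
    exists (v7 (if w == 1 :> nat then 2 else 1)).
    move: vF wF vw; rewrite !inE /= /tree7_adj -!val_eqE /=.
    case: v => -[|[|[|[|[|[|[|//]]]]]]] ? //=;
    by case: w => -[|[|[|[|[|[|[|//]]]]]]] ? //=; rewrite !inordK.
  have [||b bF bB] := fort_meets_dom_step (F := [set w : tree7 | 3 < w])
    (w0 := v7 4) _ _ Bt.
  + by rewrite inE inordK.
  + move=> v w; rewrite !inE => vF wF vw.
    exists (v7 (if w == 4 :> nat then 5 else 4)).
    move: vF wF vw; rewrite !inE /= /tree7_adj -!val_eqE /=.
    case: v => -[|[|[|[|[|[|[|//]]]]]]] ? //=;
    by case: w => -[|[|[|[|[|[|[|//]]]]]]] ? //=; rewrite !inordK.
  have [c cB ca] := near a aB; have [d dB db] := near b bB.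
  suff: 1 < #|B| by nia.
  apply/card_gt1P; exists c, d; split=> //.
  move: aF ca bF db; rewrite !inE /= /tree7_adj -!val_eqE /=.
  case: a {aB} => -[|[|[|[|[|[|[|//]]]]]]] ? //= _;
  case: c {cB} => -[|[|[|[|[|[|[|//]]]]]]] ? //= _;
  case: b {bB} => -[|[|[|[|[|[|[|//]]]]]]] ? //= _;
  by case: d {dB} => -[|[|[|[|[|[|[|//]]]]]]] ? //= _.
Qed.

(** * Nonemptiness of filling sets, and the sharp bound *)

Lemma filled_set0 (G : sgraph) (t : nat) : filled (set0 : {set G}) t = set0.
Proof.
have dom0 : dom_step (set0 : {set G}) = set0 by rewrite /dom_step set0U big_set0.
case: t => //= j; rewrite dom0; elim: j => //= j ->.
rewrite /force_step set0U; apply/setP => x; rewrite !inE.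
by apply/existsP => -[v]; rewrite inE.
Qed.

Lemma filled_setT_gt0 (G : sgraph) (B : {set G}) (t : nat) :
  0 < #|G| -> filled B t = setT -> 0 < #|B|.
Proof.
move=> G0 Bt; rewrite card_gt0; apply: contra_eq_neq Bt => ->.
by rewrite filled_set0 eq_sym -card_gt0 cardsT.
Qed.

Theorem theorem2p5 :
  (forall G : sgraph, connected_graph G -> (3 <= #|G|)%N ->
     (th G <= (6 * #|G|%:R / 7)%R%:E)%E) /\
  (exists G : sgraph, [/\ connected_graph G, (3 <= #|G|)%N &
     th G = (6 * #|G|%:R / 7)%R%:E]).
Proof.
have upper (G : sgraph) : connected_graph G -> 3 <= #|G| ->
    (th G <= (6 * #|G|%:R / 7)%R%:E)%E.
  move=> Gc G3; have [D [X [domD domX leDX]]] := domination_trade_off Gc G3.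
  have G0 : 0 < #|G| by lia.
  have thB (B : {set G}) t : filled B t = setT -> 7 * (#|B| * t.+1) <= 6 * #|G| ->
      (th G <= (6 * #|G|%:R / 7)%R%:E)%E.
    move=> Bt leB; apply: le_trans (th_le (filled_setT_gt0 G0 Bt) Bt) _.
    rewrite lee_fin ler_pdivlMr ?ltr0n // -!natrM ler_nat; lia.
  have [leD|ltD] := leqP (7 * #|D|) (3 * #|G|).
    by apply: (thB D 1 domD); lia.
  by apply: (thB X 2 domX); lia.
split=> //; exists tree7; split; first exact: tree7_connected.
  by rewrite card_ord.
apply/le_anti/andP; split; first last.
  by rewrite card_ord mulfK //; exact: le_th tree7_cost.
by apply: upper; [exact: tree7_connected|rewrite card_ord].
Qed.
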